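(* Let $\mathbb{E}$ be a finitely complete $\mathbb P$-decomposable category. Then any monomorphism $v:U\rightarrowtail T$ in $\mathbb{E}$ has a normalizer. Moreover, any normal monomorphism $u:U\rightarrowtail X$ in $\mathbb{E}$ (i.e. one normal to some equivalence relation on $X$) admits a largest equivalence relation $R_u$ on $X$ to which $u$ is normal.
   Context: Extremal decompositions. Let $\Theta$ be a class of morphisms in a category $\mathbb{D}$ and $v:U\rightarrowtail T$ a monomorphism. A decomposition $v=w.u$ with $u:U\to X$ in $\Theta$ is $\Theta$-extremal when for any other decomposition $v=w'.u'$ with $u':U\to X'$ in $\Theta$, there is a unique $t:X'\to X$ with $w.t=w'$ and $t.u'=u$. $\mathbb{D}$ has $\Theta$-extremal decompositions of monomorphisms when any monomorphism has one. Points. $\mathrm{Pt}\,\mathbb{E}$ is the category whose objects are the split epimorphisms $(f,s):X\rightleftarrows Y$, $f.s=1_Y$, with chosen splitting, and whose maps $(y,x):(f',s')\to(f,s)$ are pairs with $f.x=y.f'$ and $x.s'=s.y$. $\mathbb P_{\mathbb E}:\mathrm{Pt}\,\mathbb E\to\mathbb E$ sends $(f,s)$ to the codomain of $f$; $(y,x)$ is $\mathbb P_{\mathbb E}$-cartesian iff $f.x=y.f'$ is a pullback square. $\mathbb{E}$ is $\mathbb P$-decomposable when $\mathrm{Pt}\,\mathbb E$ has $\Theta$-extremal decompositions of monomorphisms for $\Theta$ the class of $\mathbb P_{\mathbb E}$-cartesian maps. Normalizers. A monomorphism $u:U\rightarrowtail X$ is normal to an equivalence relation $R$ on $X$ when $u^{-1}(R)=\nabla_U$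 (the indiscrete relation $U\times U$ on $U$) and the induced internal functor $\nabla_U\to R$ is a discrete fibration (the square formed with the first projections $p_0:U\times U\to U$ and $d_0:R\to X$ is a pullback). A monomorphism $v:U\rightarrowtail T$ has a normalizer when there is a pair $(u,R_v)$, with $u:U\rightarrowtail X$ normal to $R_v$, and $w:X\to T$ with $v=w.u$, universal among such decompositions: for any $u':U\rightarrowtail X'$ normal to $R'$ and $w':X'\to T$ with $v=w'.u'$, there is a unique $t:X'\to X$ with $w.t=w'$, $t.u'=u$ and $R'\subset t^{-1}(R_v)$. *)

(* Defs.v *)
From mathcomp Require Import all_boot.
From Stdlib Require Import ProofIrrelevance.

Set Implicit Arguments.
Unset Strict Implicit.
Unset Printing Implicit Defensive.

Declare Scope cat_scope.
Delimit Scope cat_scope with cat.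
Local Open Scope cat_scope.

Record category := Category {
  obj :> Type;
  hom : obj -> obj -> Type;
  idm : forall A, hom A A;
  comp : forall A B D, hom B D -> hom A B -> hom A D;
  compA : forall A B D E (h : hom D E) (g : hom B D) (f : hom A B),
    comp h (comp g f) = comp (comp h g) f;
  comp1m : forall A B (f : hom A B), comp (idm B) f = f;
  compm1 : forall A B (f : hom A B), comp f (idm A) = f
}.
Arguments hom {c} A B.
Arguments idm {c} A.
Arguments comp {c A B D} g f.

Notation "g ∘ f" := (comp g f) (at level 40, left associativity) : cat_scope.

Record functor (C D : category) := Functor {
  fobj :> C -> D;
  fmap : forall A B : C, hom A B -> hom (fobj A) (fobj B);
  fmap1 : forall A : C, fmap (idm A) = idm (fobj A);
  fmapM : forall (A B E : C) (g : hom B E) (f : hom A B),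
    fmap (g ∘ f) = fmap g ∘ fmap f
}.
Arguments fmap {C D} F {A B} f : rename.

Section Limits.
Variable C : category.

Definition mono (A B : C) (m : hom A B) : Prop :=
  forall (Z : C) (a b : hom Z A), m ∘ a = m ∘ b -> a = b.

Section FiniteDiagram.
(* A diagram over the finite graph with vertices V and edges E. The limit of a
   functor on a finite category is its limit as a diagram over the underlying
   graph: commutation conditions in the shape do not affect the cones. *)
Variables (V E : finType) (src tgt : E -> V) (F : V -> C).
Variable f : forall e, hom (F (src e)) (F (tgt e)).

Definition is_cone (L : C) (p : forall v, hom L (F v)) : Prop :=
  forall e, f e ∘ p (src e) = p (tgt e).

Definition is_limit (L : C) (p : forall v, hom L (F v)) : Prop :=
  is_cone p /\
  forall (Z : C) (q : forall v, hom Z (F v)), is_cone q ->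
    exists! h : hom Z L, forall v, p v ∘ h = q v.
End FiniteDiagram.

Definition finitely_complete : Prop :=
  forall (V E : finType) (src tgt : E -> V) (F : V -> C)
    (f : forall e, hom (F (src e)) (F (tgt e))),
  exists (L : C) (p : forall v, hom L (F v)), is_limit f p.

Definition is_product (A B P : C) (p : hom P A) (q : hom P B) : Prop :=
  forall (Z : C) (a : hom Z A) (b : hom Z B),
    exists! h : hom Z P, p ∘ h = a /\ q ∘ h = b.

Definition is_pullback (A B D P : C)
    (p : hom P A) (q : hom P B) (f : hom A D) (g : hom B D) : Prop :=
  f ∘ p = g ∘ q /\
  forall (Z : C) (a : hom Z A) (b : hom Z B), f ∘ a = g ∘ b ->
    exists! h : hom Z P, p ∘ h = a /\ q ∘ h = b.

End Limits.

Section Extremal.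
Variable D : category.
Variable Theta : forall A B : D, hom A B -> Prop.

Definition extremal_decomposition (U T X : D)
    (v : hom U T) (u : hom U X) (w : hom X T) : Prop :=
  [/\ v = w ∘ u,
      Theta u
    & forall (X' : D) (u' : hom U X') (w' : hom X' T),
        v = w' ∘ u' -> Theta u' ->
        exists! t : hom X' X, w ∘ t = w' /\ t ∘ u' = u].

Definition has_extremal_decompositions : Prop :=
  forall (U T : D) (v : hom U T), mono v ->
  exists (X : D) (u : hom U X) (w : hom X T), extremal_decomposition v u w.

End Extremal.

Definition cartesian (C D : category) (F : functor C D)
    (A B : C) (m : hom A B) : Prop :=
  forall (Z : C) (g : hom Z B) (h : hom (F Z) (F A)),
    fmap F m ∘ h = fmap F g ->
    exists! k : hom Z A, fmap F k = h /\ m ∘ k = g.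

Section Points.
Variable C : category.

Record point := Point {
  pdom : C;
  pcod : C;
  pmap : hom pdom pcod;
  psec : hom pcod pdom;
  pmapK : pmap ∘ psec = idm pcod
}.

Record point_hom (P Q : point) := PointHom {
  hcod : hom (pcod P) (pcod Q);
  hdom : hom (pdom P) (pdom Q);
  hmapE : pmap Q ∘ hdom = hcod ∘ pmap P;
  hsecE : hdom ∘ psec P = psec Q ∘ hcod
}.

Lemma point_hom_eq (P Q : point) (a b : point_hom P Q) :
  hcod a = hcod b -> hdom a = hdom b -> a = b.
Proof.
case: a => y x e1 e2; case: b => y' x' e1' e2' /= ey ex; subst y' x'.
by rewrite (proof_irrelevance _ e1 e1') (proof_irrelevance _ e2 e2').
Qed.

Definition point_id (P : point) : point_hom P P.
Proof.
by exists (idm _) (idm _); rewrite comp1m compm1.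
Defined.

Definition point_comp (P Q S : point)
    (b : point_hom Q S) (a : point_hom P Q) : point_hom P S.
Proof.
exists (hcod b ∘ hcod a) (hdom b ∘ hdom a).
- by rewrite compA hmapE -compA hmapE compA.
- by rewrite -compA hsecE compA hsecE compA.
Defined.

Definition Pt : category.
Proof.
exists point point_hom point_id point_comp.
- by move=> *; apply: point_hom_eq; apply: compA.
- by move=> *; apply: point_hom_eq; apply: comp1m.
- by move=> *; apply: point_hom_eq; apply: compm1.
Defined.

Definition point_base : functor Pt C.
Proof.
by exists (pcod : Pt -> C) (fun (P Q : Pt) (a : hom P Q) => hcod a).
Defined.

Definition P_decomposable : Prop :=
  has_extremal_decompositions (@cartesian Pt C point_base).

End Points.

Section Relations.
Variable C : category.

(* A subobject of X * X, presented by its two jointly monic projections. *)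
Record relation (X : C) := Relation {
  rel_obj :> C;
  d0 : hom rel_obj X;
  d1 : hom rel_obj X;
  rel_monic : forall (Z : C) (a b : hom Z rel_obj),
    d0 ∘ a = d0 ∘ b -> d1 ∘ a = d1 ∘ b -> a = b
}.
Arguments d0 {X} R : rename.
Arguments d1 {X} R : rename.

Definition rel_reflexive (X : C) (R : relation X) : Prop :=
  exists r : hom X R, d0 R ∘ r = idm X /\ d1 R ∘ r = idm X.

Definition rel_symmetric (X : C) (R : relation X) : Prop :=
  exists s : hom R R, d0 R ∘ s = d1 R /\ d1 R ∘ s = d0 R.

Definition rel_transitive (X : C) (R : relation X) : Prop :=
  forall (P : C) (p q : hom P R), is_pullback p q (d1 R) (d0 R) ->
  exists t : hom P R, d0 R ∘ t = d0 R ∘ p /\ d1 R ∘ t = d1 R ∘ q.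

Definition is_equivalence (X : C) (R : relation X) : Prop :=
  [/\ rel_reflexive R, rel_symmetric R & rel_transitive R].

Definition rel_incl (X : C) (R S : relation X) : Prop :=
  exists k : hom R S, d0 S ∘ k = d0 R /\ d1 S ∘ k = d1 R.

Definition is_indiscrete (U : C) (N : relation U) : Prop :=
  is_product (d0 N) (d1 N).

(* S, with phi : S -> R, is the pullback of (d0, d1) : R -> X * X along
   f * f : Y * Y -> X * X, written without the products. *)
Definition is_inverse_image (X Y : C) (f : hom Y X) (R : relation X)
    (S : relation Y) (phi : hom S R) : Prop :=
  [/\ d0 R ∘ phi = f ∘ d0 S,
      d1 R ∘ phi = f ∘ d1 S
    & forall (Z : C) (a b : hom Z Y) (r : hom Z R),
        d0 R ∘ r = f ∘ a -> d1 R ∘ r = f ∘ b ->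
        exists! h : hom Z S, [/\ d0 S ∘ h = a, d1 S ∘ h = b & phi ∘ h = r]].

Definition incl_inverse_image (X Y : C) (R' : relation Y)
    (t : hom Y X) (R : relation X) : Prop :=
  exists (S : relation Y) (phi : hom S R),
    is_inverse_image t phi /\ rel_incl R' S.

(* u is normal to R. The pair (u, ut) is the functor from the indiscrete
   relation N to R. *)
Definition normal_to (U X : C) (u : hom U X) (R : relation X) : Prop :=
  mono u /\
  exists (N : relation U) (ut : hom N R),
    [/\ is_indiscrete N,
        is_inverse_image u ut
      & is_pullback (d0 N) ut u (d0 R)].

Definition is_normalizer (U T X : C) (v : hom U T)
    (u : hom U X) (R : relation X) (w : hom X T) : Prop :=
  [/\ is_equivalence R,
      normal_to u R,
      v = w ∘ u
    & forall (X' : C) (u' : hom U X') (R' : relation X') (w' : hom X' T),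
        is_equivalence R' -> normal_to u' R' -> v = w' ∘ u' ->
        exists! t : hom X' X,
          [/\ w ∘ t = w', t ∘ u' = u & incl_inverse_image R' t R]].

Definition has_normalizer (U T : C) (v : hom U T) : Prop :=
  exists (X : C) (u : hom U X) (R : relation X) (w : hom X T),
    is_normalizer v u R w.

Definition normal_mono (U X : C) (u : hom U X) : Prop :=
  exists R : relation X, is_equivalence R /\ normal_to u R.

Definition largest_normalizing (U X : C) (u : hom U X) (R : relation X) : Prop :=
  [/\ is_equivalence R,
      normal_to u R
    & forall R' : relation X,
        is_equivalence R' -> normal_to u R' -> rel_incl R' R].

End Relations.

Section CartesianPoints.
Variable C : category.
Hypothesis fcC : finitely_complete C.

Lemma pullback_ex (A B D : C) (f : hom A D) (g : hom B D) :
  exists (P : C) (p : hom P A) (q : hom P B), is_pullback p q f g.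
Proof.
pose F (v : option bool) : C :=
  match v with None => D | Some true => A | Some false => B end.
pose e (b : bool) : hom (F (Some b)) (F None) :=
  match b with true => f | false => g end.
have [L [p [cp up]]] :=
  fcC (V := option bool) (E := bool) (src := Some) (tgt := fun=> None) e.
exists L, (p (Some true)), (p (Some false)); split.
  by rewrite (cp true : f ∘ _ = _) (cp false : g ∘ _ = _).
move=> Z a b ab.
pose q (v : option bool) : hom Z (F v) :=
  match v with None => f ∘ a | Some true => a | Some false => b end.
have cq : is_cone e q by case.
have [h [hq hu]] := up Z q cq; exists h; split.
  by split; [apply: (hq (Some true)) | apply: (hq (Some false))].
move=> k [ka kb]; apply: hu; case=> [[]|] //=.
by rewrite -(cp true) /= -ka -compA.
Qed.

Lemma pullback_uniq (A B D P Z : C) (p : hom P A) (q : hom P B)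
    (f : hom A D) (g : hom B D) (h k : hom Z P) :
  is_pullback p q f g -> p ∘ h = p ∘ k -> q ∘ h = q ∘ k -> h = k.
Proof.
move=> [sq pb] ph qh.
have [|x [_ ux]] := pb Z (p ∘ h) (q ∘ h); first by rewrite !compA sq.
by rewrite -(ux h) // -(ux k).
Qed.

Lemma cartesian_uniq (P Q Z : Pt C) (m : hom P Q) (h k : hom Z P) :
  cartesian (@point_base C) m -> hcod h = hcod k -> m ∘ h = m ∘ k -> h = k.
Proof.
move=> cart hk mk.
have [|x [_ ux]] := cart Z (m ∘ h) (hcod h).
  exact: (esym (fmapM (@point_base C) m h)).
by transitivity x; [symmetry|]; apply: ux; split; try by []; symmetry.
Qed.

Lemma cartesian_pointP (P Q : Pt C) (m : hom P Q) :
  cartesian (@point_base C) m <->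
  is_pullback (hdom m) (pmap P) (pmap Q) (hcod m).
Proof.
split=> [cart|pbP].
- split; first exact: hmapE.
  have [L [p [q pbL]]] := pullback_ex (pmap Q) (hcod m).
  have [sq pb] := pbL.
  have [|s [[ps qs] _]] := pb (pcod P) (psec Q ∘ hcod m) (idm _).
    by rewrite compA pmapK comp1m compm1.
  pose LP : Pt C := Point qs.
  pose g : @hom (Pt C) LP Q := @PointHom C LP Q (hcod m) p sq ps.
  have [|k [[k1 km] _]] := cart LP g (idm _).
    exact: (compm1 (hcod m)).
  have {}k1 : hcod k = idm _ by exact: k1.
  have km' : hdom m ∘ hdom k = p by exact: (congr1 (@hdom C LP Q) km).
  have kq : pmap P ∘ hdom k = q by rewrite hmapE k1 comp1m.
  have [phi [[phip phiq] _]] := pb _ (hdom m) (pmap P) (hmapE m).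
  have phis : phi ∘ psec P = s.
    apply: (pullback_uniq pbL); first by rewrite compA phip ps hsecE.
    by rewrite compA phiq qs pmapK.
  have phi1 : pmap LP ∘ phi = idm _ ∘ pmap P by rewrite comp1m.
  have phi2 : phi ∘ psec P = psec LP ∘ idm _ by rewrite compm1.
  pose ph : @hom (Pt C) P LP := @PointHom C P LP (idm _) phi phi1 phi2.
  have kph : k ∘ ph = idm P.
    apply: (cartesian_uniq cart).
      by rewrite [LHS](_ : _ = hcod k ∘ idm _) // k1 compm1.
    rewrite compA km compm1; apply: point_hom_eq; first exact: compm1.
    exact: phip.
  have kphi : hdom k ∘ phi = idm _ by exact: (congr1 (@hdom C P P) kph).
  move=> Z a b ab; have [h [[ha hb] hu]] := pb Z a b ab.
  exists (hdom k ∘ h); split.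
    by split; rewrite compA ?km' ?kq.
  move=> h' [ha' hb'].
  rewrite (hu (phi ∘ h')) ?compA ?kphi ?comp1m //.
  by rewrite phip phiq.
- have [sq pb] := pbP.
  move=> Z g h hE; have {}hE : hcod m ∘ h = hcod g by exact: hE.
  have [|x [[xg xh] ux]] := pb _ (hdom g) (h ∘ pmap Z).
    by rewrite hmapE -hE compA.
  have xs : x ∘ psec Z = psec P ∘ h.
    apply: (pullback_uniq pbP).
      by rewrite !compA xg !hsecE -hE compA.
    by rewrite !compA xh pmapK comp1m -compA pmapK compm1.
  exists (@PointHom C Z P h x xh xs); split.
    by split; [|apply: point_hom_eq].
  move=> k [kh km].
  have {}kh : hcod k = h by exact: kh.
  apply: point_hom_eq; first by rewrite kh.
  apply: ux; split; first exact: (congr1 (@hdom C Z Q) km).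
  by rewrite -kh hmapE.
Qed.

End CartesianPoints.

(* Main.v *)
From mathcomp Require Import all_boot.
Require Import Defs.

Set Implicit Arguments.
Unset Strict Implicit.
Unset Printing Implicit Defensive.

Local Open Scope cat_scope.

(** Why the theorem holds. Let [v : U -> T] be mono, and decompose extremally
the map of points that [v] induces from [U * U], with its first projection
and diagonal, to [T * T]. Its middle object is a point [(f, s) : W -> X],
together with [delta : W -> T] (the second component of [W -> T * T]); put
[w = delta s]. The inclusion of [U * U] is cartesian, which is the discrete
fibration condition of a normal monomorphism. So it remains to see that [W]
is an equivalence relation on [X] with first projection [f], and that
extremality then says that it is universal.

The right factor of an extremal decomposition of a mono is mono
([extremal_cartesian_mono]): its kernel pair is again a decomposition, so the
two projections coincide. Hence [w] is mono and [(f, delta)] is jointly monic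
([extremal_factorization_ex]).

The missing second projection comes from extremality, applied to the
decomposition whose middle object is the kernel pair [W2 -> W] of [f], with
[U -> W] given by [s u]. The comparison is a map [d : W -> X] with
[w d = delta], and a map [W2 -> W] above it, which sends [(x R y, x R z)] to
[y R z]. The latter, together with reflexivity, is exactly an equivalence
relation ([extremal_second_projection], [euclidean_equivalence]).

If [u : U -> X] is itself normal, it factors through its own normalizer, so
that the mono [w] is split epic, hence invertible. Transporting [R_u] along
[w] gives the largest relation. *)

(** * Products, pullbacks and monomorphisms *)

Section FiniteLimits.
Variable C : category.

Lemma mono_comp_right (A B D : C) (g : hom B D) (f : hom A B) :
  mono (g ∘ f) -> mono f.
Proof. by move=> m Z a b e; apply: m; rewrite -!compA e. Qed.

Lemma product_uniq (A B P Z : C) (p : hom P A) (q : hom P B) (h k : hom Z P) :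
  is_product p q -> p ∘ h = p ∘ k -> q ∘ h = q ∘ k -> h = k.
Proof.
move=> pq ph qh; have [x [_ ux]] := pq Z (p ∘ h) (q ∘ h).
by rewrite -(ux h) // -(ux k).
Qed.

Lemma product_ex (fcC : finitely_complete C) (A B : C) :
  exists (P : C) (p : hom P A) (q : hom P B), is_product p q.
Proof.
pose F (b : bool) : C := if b then A else B.
pose no_edge (e : void) : bool := match e with end.
pose f (e : void) : hom (F (no_edge e)) (F (no_edge e)) := match e with end.
have [L [p [_ up]]] := fcC bool void no_edge no_edge F f.
exists L, (p true), (p false) => Z a b.
pose q (v : bool) : hom Z (F v) := match v with true => a | false => b end.
have [|h [hq hu]] := up Z q; first by case.
exists h; split; first by split; [apply: (hq true) | apply: (hq false)].
by move=> k [ka kb]; apply: hu; case.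
Qed.

Lemma diagonal_ex (A P : C) (p q : hom P A) :
  is_product p q -> exists d : hom A P, p ∘ d = idm A /\ q ∘ d = idm A.
Proof. by move=> pq; have [d [hd _]] := pq A (idm A) (idm A); exists d. Qed.

Lemma inverse_image_ex (fcC : finitely_complete C) (X Y : C) (t : hom Y X)
    (R : relation X) :
  exists (S : relation Y) (phi : hom S R), is_inverse_image t phi.
Proof.
have [P [a [r pb0]]] := pullback_ex fcC t (d0 R).
have [S [b [p pb1]]] := pullback_ex fcC t (d1 R ∘ r).
have monicS Z (h k : hom Z S) :
  (a ∘ p) ∘ h = (a ∘ p) ∘ k -> b ∘ h = b ∘ k -> h = k.
  move=> ea eb; apply: (pullback_uniq pb1) => //.
  apply: (pullback_uniq pb0); first by rewrite !compA.
  have [sq0 _] := pb0; have [sq1 _] := pb1.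
  apply: (rel_monic (r := R)).
    by rewrite !compA -sq0 -!compA; congr (t ∘ _); rewrite !compA.
  by rewrite !compA -sq1 -!compA eb.
exists (Relation monicS), (r ∘ p); have [sq0 ex0] := pb0.
have [sq1 ex1] := pb1; split => /=.
- by rewrite !compA sq0.
- by rewrite compA sq1.
- move=> Z a' b' r' e0 e1.
  have [h [[ha hr] _]] := ex0 Z a' r' (esym e0).
  have [|k [[kb kp] _]] := ex1 Z b' h; first by rewrite -compA hr e1.
  exists k; split; first by rewrite -!compA kp ha hr.
  move=> k' [ka' kb' _]; apply: monicS; first by rewrite -compA kp ha ka'.
  by rewrite kb kb'.
Qed.

End FiniteLimits.

(** * Extremal decompositions have monic right factors *)

(** The diagonal [U -> K] into the kernel pair of [w] is cartesian: a map into
[K] gives two candidate lifts to [U], and [w u] identifies them. So [K] is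
another decomposition, and both its projections to [X] are comparison maps. *)
Lemma extremal_cartesian_mono (D C : category) (F : functor D C) (U T X : D)
    (v : hom U T) (u : hom U X) (w : hom X T)
    (K : D) (k0 k1 : hom K X) :
  mono v -> extremal_decomposition (@cartesian D C F) v u w ->
  is_pullback k0 k1 w w -> k0 = k1.
Proof.
move=> mv [vE cu ext] pbK; have [sq exK] := pbK.
have [e [[e0 e1] _]] := exK U u u erefl.
have ce : cartesian F e.
  move=> Z g h hE.
  have [|l [[lh l0] ul]] := cu Z (k0 ∘ g) h.
    by rewrite fmapM -hE compA -fmapM e0.
  have [|l' [[lh' l1] _]] := cu Z (k1 ∘ g) h.
    by rewrite fmapM -hE compA -fmapM e1.
  have ll' : l = l'.
    by apply: mv; rewrite vE -!compA l0 l1 !compA sq.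
  exists l; split; first split => //.
    by apply: (pullback_uniq pbK); rewrite compA ?e0 ?e1 // ll'.
  by move=> m [mh me]; apply: ul; split=> //; rewrite -me compA e0.
have vK : v = (w ∘ k0) ∘ e by rewrite -compA e0.
have [t [_ ut]] := ext K e (w ∘ k0) vK ce.
by rewrite -(ut k0) ?e0 // -(ut k1) ?e1 ?sq.
Qed.

(** * Limits of points *)

Section PointLimits.
Variable C : category.
Hypothesis fcC : finitely_complete C.

Lemma point_pullback_ex (P Q S : Pt C) (f : hom P S) (g : hom Q S) :
  exists (L : Pt C) (p : hom L P) (q : hom L Q),
    [/\ is_pullback (hdom p) (hdom q) (hdom f) (hdom g),
        is_pullback (hcod p) (hcod q) (hcod f) (hcod g)
      & is_pullback p q f g].
Proof.
have [A [a [b pbA]]] := pullback_ex fcC (hdom f) (hdom g).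
have [B [c [d pbB]]] := pullback_ex fcC (hcod f) (hcod g).
have [sqA exA] := pbA; have [sqB exB] := pbB.
have [|m [[mc md] _]] := exB A (pmap P ∘ a) (pmap Q ∘ b).
  by rewrite !compA -!hmapE -!compA sqA.
have [|s [[sa sb] _]] := exA B (psec P ∘ c) (psec Q ∘ d).
  by rewrite !compA !hsecE -!compA sqB.
have ms : m ∘ s = idm B.
  apply: (pullback_uniq pbB); rewrite compA compm1.
    by rewrite mc -compA sa compA pmapK comp1m.
  by rewrite md -compA sb compA pmapK comp1m.
pose L : Pt C := Point ms.
pose p : @hom (Pt C) L P := @PointHom C L P c a (esym mc) sa.
pose q : @hom (Pt C) L Q := @PointHom C L Q d b (esym md) sb.
exists L, p, q; split=> //; split; first exact: point_hom_eq.
move=> Z x y xy.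
have xyd : hdom f ∘ hdom x = hdom g ∘ hdom y.
  exact: (congr1 (@hdom C Z S) xy).
have xyc : hcod f ∘ hcod x = hcod g ∘ hcod y.
  exact: (congr1 (@hcod C Z S) xy).
have [h [[ha hb] uh]] := exA _ _ _ xyd.
have [k [[kc kd] uk]] := exB _ _ _ xyc.
have hk : m ∘ h = k ∘ pmap Z.
  apply: (pullback_uniq pbB); rewrite !compA.
    by rewrite mc kc -compA ha hmapE.
  by rewrite md kd -compA hb hmapE.
have hs : h ∘ psec Z = s ∘ k.
  apply: (pullback_uniq pbA); rewrite !compA.
    by rewrite ha sa -compA kc hsecE.
  by rewrite hb sb -compA kd hsecE.
exists (@PointHom C Z L k h hk hs); split.
  by split; apply: point_hom_eq.
move=> l [lp lq]; apply: point_hom_eq.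
  apply: uk; split; first exact: (congr1 (@hcod C Z P) lp).
  exact: (congr1 (@hcod C Z Q) lq).
apply: uh; split; first exact: (congr1 (@hdom C Z P) lp).
exact: (congr1 (@hdom C Z Q) lq).
Qed.

Lemma mono_of_equal_kernel_pair (A B K : C) (f : hom A B) (k0 k1 : hom K A) :
  is_pullback k0 k1 f f -> k0 = k1 -> mono f.
Proof.
move=> [_ ex] k01 Z a b ab; have [h [[ha hb] _]] := ex Z a b ab.
by rewrite -ha -hb k01.
Qed.

End PointLimits.

(** * The elementary form of an extremal decomposition *)

Section Factorization.
Variable C : category.
Variables (U T N : C) (p0 p1 : hom N U) (e : hom U N) (v : hom U T).

(** With [N = U * U] and diagonal [e], this is a decomposition, with cartesian
left factor [(u, ut)], of the map of points from [N] to [T * T] induced by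
[v]. Because [W -> T * T] is a map of points, it is determined by its second
component [delta], and the map [X -> T] below it is [delta s]. *)
Record factorization (X W : C) (f : hom W X) (s : hom X W)
    (u : hom U X) (ut : hom N W) (delta : hom W T) : Prop := Factorization {
  fact_split : f ∘ s = idm X;
  fact_cart : is_pullback p0 ut u f;
  fact_sec : ut ∘ e = s ∘ u;
  fact_tgt : delta ∘ ut = v ∘ p1
}.

Definition extremal_factorization (X W : C) (f : hom W X) (s : hom X W)
    (u : hom U X) (ut : hom N W) (delta : hom W T) : Prop :=
  [/\ factorization f s u ut delta,
      mono (delta ∘ s),
      (forall (Z : C) (a b : hom Z W),
         f ∘ a = f ∘ b -> delta ∘ a = delta ∘ b -> a = b)
    & forall (X' W' : C) (f' : hom W' X') (s' : hom X' W')
        (u' : hom U X') (ut' : hom N W') (delta' : hom W' T),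
        factorization f' s' u' ut' delta' ->
        exists (t : hom X' X) (tau : hom W' W),
          [/\ f ∘ tau = t ∘ f', tau ∘ s' = s ∘ t, delta ∘ tau = delta'
            & t ∘ u' = u]].

Hypothesis fcC : finitely_complete C.
Hypotheses (prodN : is_product p0 p1) (mv : mono v).
Hypotheses (p0e : p0 ∘ e = idm U) (p1e : p1 ∘ e = idm U).

Lemma fact_base (X W : C) (f : hom W X) (s : hom X W)
    (u : hom U X) (ut : hom N W) (delta : hom W T) :
  factorization f s u ut delta -> v = (delta ∘ s) ∘ u.
Proof.
by case=> _ _ es et; rewrite -compA -es compA et -compA p1e compm1.
Qed.

Lemma extremal_factorization_ex : P_decomposable C ->
  exists (X W : C) (f : hom W X) (s : hom X W)
    (u : hom U X) (ut : hom N W) (delta : hom W T),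
    extremal_factorization f s u ut delta.
Proof.
move=> dec.
have [T2 [q0 [q1 prodT]]] := product_ex fcC T T.
have [eT [q0e q1e]] := diagonal_ex prodT.
pose PU : Pt C := Point p0e; pose PT : Pt C := Point q0e.
have [vv [[vv0 vv1] _]] := prodT N (v ∘ p0) (v ∘ p1).
have vve : vv ∘ e = eT ∘ v.
  apply: (product_uniq prodT); rewrite !compA ?vv0 ?vv1 ?q0e ?q1e comp1m.
    by rewrite -compA p0e compm1.
  by rewrite -compA p1e compm1.
pose V : @hom (Pt C) PU PT := @PointHom C PU PT v vv vv0 vve.
have mV : mono V.
  move=> Z a b ab; apply: point_hom_eq.
    by apply: mv; exact: (congr1 (@hcod C Z PT) ab).
  have abd : vv ∘ hdom a = vv ∘ hdom b by exact: (congr1 (@hdom C Z PT) ab).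
  apply: (product_uniq prodN); apply: mv.
    by rewrite !compA -vv0 -!compA abd.
  by rewrite !compA -vv1 -!compA abd.
have [Q [u [w ext]]] := dec PU PT V mV.
have [VE cu univ] := ext.
have [K [k0 [k1 [pbd pbc pbK]]]] := point_pullback_ex fcC w w.
have k01 := extremal_cartesian_mono mV ext pbK.
have mc : mono (hcod w).
  by apply: mono_of_equal_kernel_pair pbc _; rewrite k01.
have md : mono (hdom w).
  by apply: mono_of_equal_kernel_pair pbd _; rewrite k01.
have wf : q0 ∘ hdom w = hcod w ∘ pmap Q by exact: (hmapE w).
have ws : hdom w ∘ psec Q = eT ∘ hcod w by exact: (hsecE w).
have dsE : (q1 ∘ hdom w) ∘ psec Q = hcod w.
  by rewrite -compA ws compA q1e comp1m.
have vvE : vv = hdom w ∘ hdom u by exact: (congr1 (@hdom C PU PT) VE).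
exists (pcod Q), (pdom Q), (pmap Q), (psec Q), (hcod u), (hdom u),
  (q1 ∘ hdom w); split.
- split; first exact: pmapK.
  + have [sq pb] := (cartesian_pointP fcC u).1 cu.
    split; first exact: esym.
    move=> Z a b ab; have [h [[hb ha] uh]] := pb Z b a (esym ab).
    by exists h; split=> // k [ka kb]; apply: uh.
  + exact: (hsecE u).
  + by rewrite -compA -vvE vv1.
- by rewrite dsE.
- move=> Z a b fab dab; apply: md; apply: (product_uniq prodT).
    by rewrite !compA wf -!compA fab.
  by rewrite !compA.
- move=> X' W' f' s' u' ut' delta' fact; have vE' := fact_base fact.
  case: fact => fs' pb' se' te'.
  pose P' : Pt C := Point fs'.
  have utE : f' ∘ ut' = u' ∘ p0 by case: pb' => ->.
  pose V0 : @hom (Pt C) PU P' := @PointHom C PU P' u' ut' utE se'.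
  have [x [[x0 x1] _]] := prodT W' ((delta' ∘ s') ∘ f') delta'.
  have xs : x ∘ s' = eT ∘ (delta' ∘ s').
    apply: (product_uniq prodT); rewrite !compA ?x0 ?x1 ?q0e ?q1e ?comp1m //.
    by rewrite -[LHS]compA fs' compm1.
  pose V1 : @hom (Pt C) P' PT := @PointHom C P' PT (delta' ∘ s') x x0 xs.
  have VE' : V = V1 ∘ V0.
    apply: point_hom_eq; first exact: vE'.
    rewrite [LHS]/= [RHS]/=; apply: (product_uniq prodT).
      by rewrite vv0 compA x0 -compA utE compA -vE'.
    by rewrite vv1 compA x1 te'.
  have cV0 : cartesian (@point_base C) V0.
    apply/(cartesian_pointP fcC); case: pb' => sq pb.
    split; first exact: utE.
    move=> Z a b ab; have [h [[hb ha] uh]] := pb Z b a (esym ab).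
    by exists h; split=> // k [ka kb]; apply: uh.
  have [t [[t1 t0] _]] := univ P' V0 V1 VE' cV0.
  exists (hcod t), (hdom t); split; first exact: (hmapE t).
  + exact: (hsecE t).
  + by rewrite -compA -x1; congr (_ ∘ _); exact: (congr1 (@hdom C P' PT) t1).
  + exact: (congr1 (@hcod C PU Q) t0).
Qed.

(** Apply extremality to the kernel pair [W2] of [f], seen as a point over [W]
and receiving [U] through [s u]; in terms of elements, the fibre of [W2] over
[x R y] is the fibre of [W] over [x], so that restricting to [U] again gives
[U * U]. *)
Lemma extremal_second_projection (X W W2 : C) (f : hom W X) (s : hom X W)
    (u : hom U X) (ut : hom N W) (delta : hom W T) (r0 r1 : hom W2 W) :
  extremal_factorization f s u ut delta -> is_pullback r0 r1 f f ->
  exists (d : hom W X) (tau : hom W2 W),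
    [/\ (delta ∘ s) ∘ d = delta, f ∘ tau = d ∘ r0
      & d ∘ tau = d ∘ r1].
Proof.
move=> [[fs [sqU pbU] es et] mw _ univ] pb2; have [sq2 ex2] := pb2.
have [dg [[dg0 dg1] _]] := ex2 W (idm W) (idm W) erefl.
have [|vt [[vt0 vt1] _]] := ex2 N (s ∘ u ∘ p0) ut.
  by rewrite !compA fs comp1m.
have fact2 : factorization r0 dg (s ∘ u) vt (delta ∘ r1).
  split=> //.
  - split=> // Z a b ab.
    have [|h [[ha hb] uh]] := pbU Z a (r1 ∘ b).
      by rewrite compA -sq2 -compA -ab !compA fs comp1m.
    exists h; split; first split => //.
      apply: (pullback_uniq pb2); first by rewrite compA vt0 -ab -compA ha.
      by rewrite compA vt1.
    by move=> k [ka kb]; apply: uh; split=> //; rewrite -kb compA vt1.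
  - apply: (pullback_uniq pb2); rewrite !compA.
      by rewrite vt0 dg0 comp1m -compA p0e compm1.
    by rewrite vt1 es dg1 comp1m.
  - by rewrite -compA vt1.
have [d [tau [ftau taud dtau _]]] := univ _ _ _ _ _ _ _ fact2.
have wd : (delta ∘ s) ∘ d = delta.
  by rewrite -compA -taud compA dtau -compA dg1 compm1.
by exists d, tau; split=> //; apply: mw; rewrite !compA wd dtau.
Qed.

End Factorization.

(** * Equivalence relations *)

Section Equivalences.
Variable C : category.

(** A reflexive Euclidean relation is an equivalence relation: symmetry comes
from the pair [(x R y, x R x)], and transitivity from [(y R x, y R z)]. *)
Lemma euclidean_equivalence (X : C) (R : relation X) (W2 : C)
    (r0 r1 tau : hom W2 R) :
  rel_reflexive R -> is_pullback r0 r1 (d0 R) (d0 R) ->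
  d0 R ∘ tau = d1 R ∘ r0 -> d1 R ∘ tau = d1 R ∘ r1 ->
  is_equivalence R.
Proof.
move=> [s [s0 s1]] [_ ex2] tau0 tau1.
have [|h [[h0 h1] _]] := ex2 R (idm R) (s ∘ d0 R).
  by rewrite compA s0 comp1m compm1.
have sym0 : d0 R ∘ (tau ∘ h) = d1 R by rewrite compA tau0 -compA h0 compm1.
have sym1 : d1 R ∘ (tau ∘ h) = d0 R.
  by rewrite compA tau1 -compA h1 compA s1 comp1m.
split; [by exists s | by exists (tau ∘ h) |].
move=> P p q [sq _].
have [|k [[k0 k1] _]] := ex2 P (tau ∘ h ∘ p) q.
  by rewrite compA sym0.
exists (tau ∘ k); split.
  by rewrite compA tau0 -compA k0 compA sym1.
by rewrite compA tau1 -compA k1.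
Qed.

(** [u^-1(R)] is indiscrete as soon as [U * U -> R] is a functor and the
discrete fibration square is a pullback: the latter lifts an element of [R]
between points of [U], and [u] being mono identifies its target. *)
Lemma normal_to_intro (U X N : C) (u : hom U X) (R : relation X)
    (p0 p1 : hom N U) (ut : hom N R) :
  mono u -> is_product p0 p1 -> is_pullback p0 ut u (d0 R) ->
  d1 R ∘ ut = u ∘ p1 -> normal_to u R.
Proof.
move=> mu pN pb e1; split=> //; have [sq ex] := pb.
have monicN Z (a b : hom Z N) : p0 ∘ a = p0 ∘ b -> p1 ∘ a = p1 ∘ b -> a = b.
  exact: product_uniq.
exists (Relation monicN), ut; split=> //; split=> //= Z a b r ra rb.
have [h [[ha hr] uh]] := ex Z a r (esym ra).
exists h; split; last by move=> k [ka _ kr]; apply: uh.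
by split=> //; apply: mu; rewrite compA -e1 -compA hr.
Qed.

Lemma normal_to_elim (U X : C) (u : hom U X) (R : relation X) (N : C)
    (p0 p1 : hom N U) :
  is_product p0 p1 -> normal_to u R ->
  exists ut : hom N R, is_pullback p0 ut u (d0 R) /\ d1 R ∘ ut = u ∘ p1.
Proof.
move=> pN [_ [M [ut [iM [_ e1 _] [sq ex]]]]].
have [i [[i0 i1] _]] := iM N p0 p1.
have [j [[j0 j1] _]] := pN M (d0 M) (d1 M).
have ij : i ∘ j = idm _.
  by apply: (product_uniq iM); rewrite compA ?i0 ?i1 ?j0 ?j1 compm1.
have ji : j ∘ i = idm _.
  by apply: (product_uniq pN); rewrite compA ?i0 ?i1 ?j0 ?j1 compm1.
exists (ut ∘ i); split; last by rewrite compA e1 -compA i1.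
split; first by rewrite compA -sq -compA i0.
move=> Z a b ab; have [h [[ha hb] uh]] := ex Z a b ab.
exists (j ∘ h); split.
  by rewrite !compA j0 -(compA ut) ij compm1.
move=> k [ka kb]; rewrite (uh (i ∘ k)) ?compA ?ji ?comp1m // i0.
by split.
Qed.

Lemma image_relation_monic (X Y : C) (R : relation X) (m : hom X Y) :
  mono m -> forall (Z : C) (a b : hom Z R),
  (m ∘ d0 R) ∘ a = (m ∘ d0 R) ∘ b -> (m ∘ d1 R) ∘ a = (m ∘ d1 R) ∘ b -> a = b.
Proof.
move=> mm Z a b; rewrite -!compA => e0 e1.
by apply: (rel_monic (r := R)); apply: mm.
Qed.

(** The relation on [Y] with the same elements as [R]; when [m] is invertible,
it is the transport of [R] along [m]. *)
Definition image_relation (X Y : C) (R : relation X) (m : hom X Y)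
    (mm : mono m) : relation Y :=
  Relation (image_relation_monic (R := R) mm).

Lemma image_equivalence (X Y : C) (R : relation X) (m : hom X Y)
    (mm : mono m) (t : hom Y X) :
  m ∘ t = idm Y -> is_equivalence R -> is_equivalence (image_relation R mm).
Proof.
move=> mt [[r [r0 r1]] [s [s0 s1]] trans]; split.
- exists (r ∘ t) => /=; rewrite -!compA (compA (d0 R)) (compA (d1 R)).
  by rewrite r0 r1 comp1m.
- by exists s => /=; rewrite -!compA s0 s1.
- move=> P p q [/= sq ex]; have [|k [k0 k1]] := trans P p q.
    split; first by apply: (mm); rewrite !compA.
    by move=> Z a b ab; apply: ex; rewrite -!compA ab.
  by exists k; rewrite -!compA k0 k1.
Qed.

Lemma image_normal_to (U X Y : C) (R : relation X) (m : hom X Y)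
    (mm : mono m) (u : hom U X) :
  normal_to u R -> normal_to (m ∘ u) (image_relation R mm).
Proof.
move=> [mu [N [ut [iN [e0 e1 _] [sq ex]]]]].
apply: (@normal_to_intro _ _ _ _ (image_relation R mm) (d0 N) (d1 N) ut) => //=.
- by move=> Z a b; rewrite -!compA => /mm /mu.
- split; first by rewrite -!compA sq.
  by move=> Z a b; rewrite -!compA => /mm; apply: ex.
- by rewrite -!compA e1.
Qed.

End Equivalences.

(** * Normalizers *)

Section Normalizers.
Variable C : category.
Hypotheses (fcC : finitely_complete C) (decC : P_decomposable C).

(** An equivalence relation to which [u'] is normal is a decomposition whose
point is [d0] with the reflexivity map, so extremality gives both [t] and the
inclusion of relations. *)
Lemma normalizer_ex (U T : C) (v : hom U T) : mono v ->
  exists (X : C) (u : hom U X) (R : relation X) (w : hom X T),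
    is_normalizer v u R w /\ mono w.
Proof.
move=> mv.
have [N [p0 [p1 pN]]] := product_ex fcC U U.
have [e [p0e p1e]] := diagonal_ex pN.
have [X [W [f [s [u [ut [delta ext]]]]]]] :=
  extremal_factorization_ex fcC pN mv p0e p1e decC.
have [W2 [r0 [r1 pb2]]] := pullback_ex fcC f f.
have [d [tau [wd tau0 tau1]]] := extremal_second_projection p0e ext pb2.
have [fact mw monicW univ] := ext.
have vE := fact_base p1e fact; set w := delta ∘ s in vE wd mw.
case: fact => fs pbU es et.
have monicR Z (a b : hom Z W) : f ∘ a = f ∘ b -> d ∘ a = d ∘ b -> a = b.
  by move=> fab dab; apply: monicW => //; rewrite -wd -!compA dab.
pose R : relation X := Relation monicR.
exists X, u, R, w; split=> //; split=> //.
- apply: (@euclidean_equivalence _ _ R W2 r0 r1 tau) => //.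
  by exists s; split=> //; apply: mw; rewrite compA wd compm1.
- apply: (normal_to_intro (R := R) _ pN pbU).
    by apply: (@mono_comp_right _ _ _ _ w); rewrite -vE.
  by apply: mw; rewrite !compA wd -vE et.
- move=> X' u' R' w' [[s' [s0 s1]] _ _] nu' vE'.
  have [ut' [pbU' e1']] := normal_to_elim pN nu'.
  have fact' : factorization p0 p1 e v (d0 R') s' u' ut' (w' ∘ d1 R').
    split=> //; last by rewrite -compA e1' compA -vE'.
    apply: (rel_monic (r := R')); rewrite !compA.
      by case: pbU' => <- _; rewrite s0 comp1m -compA p0e compm1.
    by rewrite e1' s1 comp1m -compA p1e compm1.
  have [t [sg [sg0 sgs sg1 tu]]] := univ _ _ _ _ _ _ _ fact'.
  have wt : w ∘ t = w'.
    by rewrite -compA -sgs compA sg1 -compA s1 compm1.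
  exists t; split; last by move=> t' [wt' _ _]; apply: mw; rewrite wt wt'.
  split=> //; have [S [phi inv]] := inverse_image_ex fcC t R.
  exists S, phi; split=> //; case: inv => _ _ ex.
  have [||k [[k0 k1 _] _]] := ex R' (d0 R') (d1 R') sg => //.
    by apply: mw; rewrite !compA wd sg1 wt.
  by exists k.
Qed.

Lemma largest_normalizing_ex (U X : C) (u : hom U X) :
  normal_mono u -> exists Ru : relation X, largest_normalizing u Ru.
Proof.
move=> [R0 [eR0 nR0]]; have mu : mono u by case: nR0.
have [Y [u1 [R [w [[eR nR uE univ] mw]]]]] := normalizer_ex mu.
(* Each relation to which [u] is normal splits [w], and [w] being mono, always
   by the same map. *)
have factor (R' : relation X) : is_equivalence R' -> normal_to u R' ->
    exists t : hom X Y, w ∘ t = idm X /\ incl_inverse_image R' t R.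
  move=> eR' nR'; have [|t [[wt _ it] _]] := univ X u R' (idm X) eR' nR'.
    by rewrite comp1m.
  by exists t.
have [t [wt _]] := factor R0 eR0 nR0.
exists (image_relation R mw); split.
- exact: image_equivalence wt eR.
- by rewrite uE; exact: image_normal_to.
- move=> R' eR' nR'; have [t' [wt' [S [phi [[i0 i1 _] [k [k0 k1]]]]]]] :=
    factor R' eR' nR'.
  exists (phi ∘ k) => /=; rewrite -!compA (compA (d0 R)) (compA (d1 R)) i0 i1.
  by rewrite -!compA k0 k1 !(compA w t') wt' !comp1m.
Qed.

End Normalizers.

Theorem proposition4p2 (E : category)
    (fcE : finitely_complete E) (decE : P_decomposable E) :
  (forall (U T : E) (v : hom U T), mono v -> has_normalizer v) /\
  (forall (U X : E) (u : hom U X), normal_mono u ->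
     exists Ru : relation X, largest_normalizing u Ru).
Proof.
split=> [U T v mv | U X u]; last exact: largest_normalizing_ex.
have [X [u [R [w [nw _]]]]] := normalizer_ex fcE decE mv.
by exists X, u, R, w.
Qed.
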